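(* Assume that $\mathcal K_{js}$ is nonempty, that the sublevel set $\mathcal K_{js,\gamma}$ is compact, and that $J_{SA}$ is continuously differentiable and $L$-smooth on $\mathcal K_{js,\gamma}$ for some $L>0$. Let $c_d>0$ be a constant such that $\langle\nabla J_{SA}(K),\Delta(K)\rangle\le -c_d\|\Delta(K)\|_F^2$ for all $K\in\mathcal K_{js,\gamma}$. Let $\bar\alpha>0$, $\alpha=\min\{\bar\alpha,\,c_d/L\}$, $K_0\in\mathcal K_{js,\gamma}$, and let $\{K_i\}_{i\ge0}$ be generated by $K_{i+1}=K_i+\alpha\Delta_i$ with $\Delta_i=\Delta(K_i)$, where $\bar\alpha$ is such that $K_i+a\Delta_i\in\mathcal K_{js}$ for every $i\ge0$ and every $a\in[0,\bar\alpha]$. Then: 1. The sequence $\{K_i\}$ remains in $\mathcal K_{js,\gamma}$ and therefore has accumulation points. 2. The sequence $\{J_{SA}(K_i)\}$ is monotone nonincreasing and convergent. 3. $\|\Delta_i\|_F\to0$ as $i\to\infty$. 4. $\|\nabla J_{SA}(K_i)\|_F\to0$ as $i\to\infty$. 5. Every accumulation point of $\{K_i\}$ is a stationary point of $J_{SA}$.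
   Context: Let $M\ge 1$, $[M]=\{1,\dots,M\}$, and let $(A_j,B_j)$, $j\in[M]$, be given (sampled) system matrices with $A_j\in\mathbb{R}^{n\times n}$, $B_j\in\mathbb{R}^{n\times m}$. Let $Q\in\mathbb{R}^{n\times n}$ be symmetric with $Q\succeq 0$ and $R\in\mathbb{R}^{m\times m}$ symmetric with $R\succ 0$. $\rho(\cdot)$ denotes the spectral radius, $\langle\cdot,\cdot\rangle$ the Frobenius inner product and $\|\cdot\|_F$ the Frobenius norm. Define $$\mathcal K_{js}=\{K\in\mathbb{R}^{m\times n}:\rho(A_j+B_jK)<1\ \ \forall j\in[M]\}.$$ For $K\in\mathcal K_{js}$ let $P_j(K)$, $\Sigma_j(K)$ be the unique solutions of $$P_j=Q+K^\top RK+(A_j+B_jK)^\top P_j(A_j+B_jK),$$ $$\Sigma_j=I+(A_j+B_jK)\Sigma_j(A_j+B_jK)^\top .$$ The sample-average objective is $J_{SA}(K)=\frac1M\sum_{j=1}^M\mathrm{Tr}\big((Q+K^\top RK)\Sigma_j(K)\big)$ for $K\in\mathcal K_{js}$. For a fixed finite $\gamma$, $\mathcal K_{js,\gamma}=\{K\in\mathcal K_{js}:J_{SA}(K)\le\gamma\}$. ''$L$-smooth on $\mathcal K_{js,\gamma}$'' means that $\nabla J_{SA}$ is $L$-Lipschitz in the Frobenius norm on $\mathcal K_{js,\gamma}$. For $K\in\mathcal K_{js}$, let $\widehat K(K)$ be the unique solution $\widehat K\in\mathbb{R}^{m\times n}$ of $$\sum_{j=1}^M\Big[(R+B_j^\top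 P_j(K)B_j)\widehat K+B_j^\top P_j(K)A_j\Big]\Sigma_j(K)=0,$$ and let $\Delta(K):=\widehat K(K)-K$ be the policy-improvement direction. A stationary point of $J_{SA}$ is a $K\in\mathcal K_{js}$ with $\nabla J_{SA}(K)=0$. *)

(* Defs.v *)
From HB Require Import structures.
From mathcomp Require Import all_boot all_order all_algebra.
From mathcomp Require Import complex.
From mathcomp Require Import all_classical all_reals all_analysis.

Set Implicit Arguments.
Unset Strict Implicit.
Unset Printing Implicit Defensive.

Import Order.TTheory GRing.Theory Num.Theory.
Import numFieldNormedType.Exports.

Local Open Scope classical_set_scope.
Local Open Scope ring_scope.

Definition psdmx (R : realType) (n : nat) (S : 'M[R]_n) : Prop :=
  S^T = S /\ forall x : 'cV[R]_n, 0 <= (x^T *m S *m x) 0 0.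

Definition pdmx (R : realType) (n : nat) (S : 'M[R]_n) : Prop :=
  S^T = S /\ forall x : 'cV[R]_n, x != 0 -> 0 < (x^T *m S *m x) 0 0.

(* The eigenvalues are those of the complexified matrix.  [`|z|] lives in
   [R[i]] with zero imaginary part, hence the real part. *)
Definition spectral_radius (R : realType) (n : nat) (A : 'M[R]_n) : R :=
  sup [set complex.Re `|z| | z in
        [set z : R[i] | eigenvalue (map_mx (real_complex R) A) z]].

Definition frob_inner (R : realType) (p q : nat) (A B : 'M[R]_(p, q)) : R :=
  \sum_i \sum_j A i j * B i j.

(* The library norm on matrices is the max norm, hence this one. *)
Definition frob_norm (R : realType) (p q : nat) (A : 'M[R]_(p, q)) : R :=
  Num.sqrt (frob_inner A A).

(* Meaningful where [f] is differentiable: it then represents ['d f K] for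
   [frob_inner]. *)
Definition gradient (R : realType) (p q : nat) (f : 'M[R]_(p, q) -> R)
    (K : 'M[R]_(p, q)) : 'M[R]_(p, q) :=
  \matrix_(i, j) 'D_(delta_mx i j) f K.

Definition C1_on (R : realType) (p q : nat) (f : 'M[R]_(p, q) -> R)
    (S : set 'M[R]_(p, q)) : Prop :=
  (forall K, S K -> differentiable f K) /\
  {within S, continuous (gradient f)}.

Definition smooth_on (R : realType) (p q : nat) (L : R)
    (f : 'M[R]_(p, q) -> R) (S : set 'M[R]_(p, q)) : Prop :=
  forall K K', S K -> S K' ->
    frob_norm (gradient f K - gradient f K') <= L * frob_norm (K - K').

Section SampledLQR.
Variables (R : realType) (M n m : nat).
Variables (A : 'I_M -> 'M[R]_n) (B : 'I_M -> 'M[R]_(n, m)).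
Variables (Qc : 'M[R]_n) (Rc : 'M[R]_m).
Implicit Types K : 'M[R]_(m, n).

Definition closed_loop (j : 'I_M) K : 'M[R]_n := A j + B j *m K.

Definition Kjs : set 'M[R]_(m, n) :=
  [set K | forall j, spectral_radius (closed_loop j K) < 1].

Definition stage_cost K : 'M[R]_n := Qc + K^T *m Rc *m K.

(* [xget 0 E] is the unique solution of [E] when there is exactly one, which is
   the case below for [K] in [Kjs], [Qc] positive semidefinite and [Rc] positive
   definite (and [0 < M] for [Khat]).  Outside [Kjs], a set which is open, the
   values carry no meaning. *)
Definition Pmx (j : 'I_M) K : 'M[R]_n :=
  xget 0 [set P | P = stage_cost K
                      + (closed_loop j K)^T *m P *m closed_loop j K].

Definition Sigmamx (j : 'I_M) K : 'M[R]_n :=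
  xget 0 [set S | S = 1%:M + closed_loop j K *m S *m (closed_loop j K)^T].

Definition JSA K : R :=
  M%:R^-1 * \sum_j \tr (stage_cost K *m Sigmamx j K).

Definition Kjs_sub (gamma : R) : set 'M[R]_(m, n) :=
  [set K | Kjs K /\ JSA K <= gamma].

Definition Khat K : 'M[R]_(m, n) :=
  xget 0 [set X | \sum_j ((Rc + (B j)^T *m Pmx j K *m B j) *m X
                          + (B j)^T *m Pmx j K *m A j) *m Sigmamx j K = 0].

Definition Delta K : 'M[R]_(m, n) := Khat K - K.

(* Differentiability is included since [gradient] is total. *)
Definition stationary K : Prop :=
  [/\ Kjs K, differentiable JSA K & gradient JSA K = 0].

End SampledLQR.

(* Main.v *)
Require Import Defs.
From HB Require Import structures.
From mathcomp Require Import all_boot all_order all_algebra.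
From mathcomp Require Import complex.
From mathcomp Require Import all_classical all_reals all_analysis.
From mathcomp Require Import ring.

(** Along each step the cost stays below its quadratic upper bound.  Since
    smoothness is only assumed on the sublevel set, one follows the segment up
    to the last point [s] before which it lies in that set: compactness puts
    the endpoint in the set, and there the slope along the direction is still
    negative when [s < c_d / L], so the cost decreases further and the segment
    cannot leave.  Hence the costs decrease by at least a multiple of
    [||Delta_i||^2], and [Delta_i] tends to [0].

    To pass from [Delta_i] to the gradient one needs the policy gradient
    formula.  With [G_j = R + B_j^T P_j B_j] and
    [E_j = G_j K + B_j^T P_j A_j], the exact cost difference identity
    [J_j(K + D) - J_j(K) =
       tr ((D^T E_j + E_j^T D + D^T G_j D) Sigma_j(K + D))]
    and the continuity of [Sigma_j] give
    [grad J(K) = 2/M sum_j E_j Sigma_j], which by the equation defining [Khat]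
    equals [- 2/M sum_j G_j Delta Sigma_j].  As [G_j] and [Sigma_j] are
    continuous, hence bounded on the compact sublevel set, the gradient is
    bounded there by a multiple of [Delta]. *)

Import Order.TTheory GRing.Theory Num.Theory.
Import numFieldNormedType.Exports.

Local Open Scope classical_set_scope.
Local Open Scope ring_scope.

Set Implicit Arguments.
Unset Strict Implicit.
Unset Printing Implicit Defensive.

(** * Powers of a matrix with spectral radius below one *)

(** Induction on the roots, with [V] absorbing one factor at a time: the induction hypothesis makes
    [V * (A - b%:M) * A ^+ k] decay, and [V * A ^+ k.+1] is [b] times [V * A ^+ k] plus that
    decaying term. This replaces a Jordan form. *)
Lemma annihilated_decay (C : numFieldType) (n : nat) (A : 'M[C]_n.+1)
    (s : seq C) (V : 'M[C]_n.+1) :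
  (forall b, b \in s -> `|b| < 1) -> V * \prod_(b <- s) (A - b%:M) = 0 ->
  exists c r : C, [/\ 0 <= c, 0 < r, r < 1 &
    forall k i j, `|(V * A ^+ k) i j| <= c * r ^+ k].
Proof.
elim: s V => [V _|b s IH V s_lt1].
  rewrite big_nil mulr1 => ->; exists 0, (2^-1).
  split=> //; first by rewrite invf_lt1// ltr1n.
  by move=> k i j; rewrite mul0r mxE normr0 mul0r.
rewrite big_cons mulrA => /IH [b' b's|c [r [c0 r0 r1 Hk]]].
  by apply: s_lt1; rewrite inE b's orbT.
have b1 : `|b| < 1 by apply: s_lt1; rewrite inE eqxx.
have q0 : 0 < 1 - `|b| by rewrite subr_gt0.
(* The rate [q] dominates [r], and [q - `|b| = r * (1 - `|b|)] is positive. *)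
pose q := `|b| + r * (1 - `|b|).
have q_gt0 : 0 < q by rewrite ltr_wpDl// mulr_gt0.
have c'0 : 0 <= c / (r * (1 - `|b|)) by rewrite divr_ge0// mulr_ge0// ltW.
(* The first summand bounds the entries of [V], which is the case [k = 0]; the second makes
   [d * (q - |b|)] at least [c], which absorbs the decaying term at each step. *)
pose d := \sum_i \sum_j `|V i j| + c / (r * (1 - `|b|)).
have sum0 : 0 <= \sum_i \sum_j `|V i j|.
  by apply: sumr_ge0 => i _; exact: sumr_ge0.
exists d, q; split=> //.
- exact: addr_ge0.
- rewrite -subr_gt0 /q opprD addrA -[X in X - _]mul1r -mulrBl.
  by rewrite mulr_gt0// subr_gt0.
move=> k i j; elim: k => [|k IHk].
  rewrite expr0 !mulr1 ler_wpDr// (bigD1 i)//= (bigD1 j)//=.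
  rewrite -addrA ler_wpDr// addr_ge0//; first exact: sumr_ge0.
  by apply: sumr_ge0 => i' _; exact: sumr_ge0.
have -> : V * A ^+ k.+1 = b *: (V * A ^+ k) + V * (A - b%:M) * A ^+ k.
  rewrite exprS mulrBr mulrBl mulrA addrC [V * b%:M]mul_mx_scalar.
  by rewrite -scalerAl subrK.
rewrite mxE mxE (le_trans (ler_normD _ _))// normrM.
have rq : r <= q.
  rewrite -subr_ge0; have -> : q - r = `|b| * (1 - r) by rewrite /q; ring.
  by rewrite mulr_ge0// subr_ge0 ltW.
apply: (@le_trans _ _ (`|b| * (d * q ^+ k) + c * q ^+ k)).
  apply: lerD; first exact: ler_wpM2l.
  apply: (le_trans (Hk _ _ _)); apply: ler_wpM2l => //.
  by apply: lerXn2r rq; rewrite nnegrE ltW.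
rewrite mulrA -mulrDl exprS mulrA ler_wpM2r ?exprn_ge0 ?(ltW q_gt0)//.
have -> : d * q = `|b| * d + d * (r * (1 - `|b|)) by rewrite /q; ring.
rewrite lerD2l /d mulrDl divfK ?lerDr.
  by rewrite mulr_ge0// mulr_ge0// ltW.
by rewrite mulf_neq0// lt0r_neq0.
Qed.

(** The characteristic polynomial splits, and by Cayley-Hamilton the product of the [A - b%:M] over
    its roots vanishes. *)
Lemma spectral_decay (C : numClosedFieldType) (n : nat) (A : 'M[C]_n.+1) :
  (forall z, eigenvalue A z -> `|z| < 1) ->
  exists c r : C, [/\ 0 <= c, 0 < r, r < 1 &
    forall k i j, `|(A ^+ k) i j| <= c * r ^+ k].
Proof.
move=> A_lt1; have [s char_s] := closed_field_poly_normal (char_poly A).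
have s_lt1 b : b \in s -> `|b| < 1.
  move=> bs; apply: A_lt1; rewrite eigenvalue_root_char char_s.
  rewrite (monicP (char_poly_monic A)) scale1r root_prod_XsubC//.
have : 1 * \prod_(b <- s) (A - b%:M) = 0.
  rewrite mul1r -[RHS](Cayley_Hamilton A) char_s.
  rewrite (monicP (char_poly_monic A)) scale1r rmorph_prod/=.
  by apply: eq_bigr => b _; rewrite rmorphB/= horner_mx_X horner_mx_C.
move=> /(annihilated_decay s_lt1) [c [r [c0 r0 r1 H]]].
by exists c, r; split=> // k i j; have := H k i j; rewrite mul1r.
Qed.

Lemma eigenvalue_lt1 (R : realType) (n : nat) (A : 'M[R]_n) (z : R[i]) :
  spectral_radius A < 1 ->
  eigenvalue (map_mx (real_complex R) A) z -> `|z| < 1.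
Proof.
move=> A1 Az; have re_norm (w : R[i]) : `|w| = (complex.Re `|w|)%:C%C.
  by rewrite RRe_real// normr_real.
suff: complex.Re `|z| <= spectral_radius A.
  by move=> /le_lt_trans/(_ A1); rewrite re_norm -ltcR.
have [s char_s] :=
  closed_field_poly_normal (char_poly (map_mx (real_complex R) A)).
apply: ub_le_sup; last by exists z.
(* [sup] dominates the moduli only if they are bounded above; their sum over the roots of the
   characteristic polynomial is a bound. *)
exists (\sum_(b <- s) complex.Re `|b|) => _ [w /= Aw <-].
have ws : w \in s.
  move: Aw; rewrite eigenvalue_root_char char_s.
  by rewrite (monicP (char_poly_monic _)) scale1r root_prod_XsubC.
rewrite (big_rem w ws)/= lerDl sumr_ge0// => b _.
by rewrite -lecR -re_norm; exact: normr_ge0.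
Qed.

Lemma spectral_radius_decay (R : realType) (n : nat) (A : 'M[R]_n.+1) :
  spectral_radius A < 1 ->
  exists c r : R, [/\ 0 <= c, 0 < r, r < 1 &
    forall k i j, `|(A ^+ k) i j| <= c * r ^+ k].
Proof.
move=> A1; have [z|c [r [c0 r0 r1 H]]] :=
    @spectral_decay _ _ (map_mx (real_complex R) A).
  exact: eigenvalue_lt1.
(* Complex numbers comparable to [0] are real, so the bound descends to [R]. *)
have [cR rR] : c \is Num.real /\ r \is Num.real.
  by split; rewrite realE ?c0 ?(ltW r0).
move: c0 r0 r1 H; rewrite -(RRe_real cR) -(RRe_real rR).
set c' := complex.Re c; set r' := complex.Re r => c0 r0 r1 H.
exists c', r'; split.
- by rewrite -lecR.
- by rewrite -ltcR.
- by rewrite -ltcR.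
move=> k i j; have := H k i j; rewrite -rmorphXn/= mxE.
by rewrite normc_def/= expr0n/= addr0 sqrtr_sqr -rmorphXn -rmorphM lecR.
Qed.

(** * Limits of matrices and Lyapunov equations *)

Section MatrixLimits.
Context (R : realType) (T : Type) (F : set_system T) {FF : Filter F}.

Lemma cvg_mxP (p q : nat) (f : T -> 'M[R]_(p, q)) (l : 'M[R]_(p, q)) :
  f @ F --> l <-> forall i j, f x i j @[x --> F] --> l i j.
Proof.
split=> [fl i j|fl].
  exact: (@continuous_cvg _ _ _ F FF f (fun M => M i j) l
    (@coord_continuous _ _ _ i j l) fl).
apply/cvgrPdist_le => /= e e0.
have : \forall x \near F, forall ij : 'I_p * 'I_q,
    `|l ij.1 ij.2 - f x ij.1 ij.2| <= e.
  apply: filter_forall => -[i j] /=.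
  by have /cvgrPdist_le/(_ _ e0) := fl i j.
apply: filterS => x Hx.
rewrite /Num.Def.normr/= mx_normrE (bigmax_le _ (ltW e0))//= => ij _.
by rewrite !mxE; exact: Hx.
Qed.

Lemma cvg_sumr (I : Type) (r : seq I) (P : pred I) (f : I -> T -> R)
    (l : I -> R) :
  (forall i, P i -> f i x @[x --> F] --> l i) ->
  \sum_(i <- r | P i) f i x @[x --> F] --> \sum_(i <- r | P i) l i.
Proof. by apply: cvg_big; exact: add_continuous. Qed.

Lemma cvg_mulmx (p q s : nat) (f : T -> 'M[R]_(p, q)) (g : T -> 'M[R]_(q, s))
    (a : 'M[R]_(p, q)) (b : 'M[R]_(q, s)) :
  f @ F --> a -> g @ F --> b -> f x *m g x @[x --> F] --> a *m b.
Proof.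
move=> /cvg_mxP fa /cvg_mxP gb; apply/cvg_mxP => i j.
under eq_fun do rewrite mxE.
by rewrite mxE; apply: cvg_sumr => k _; exact: cvgM.
Qed.

Lemma cvg_trmx (p q : nat) (f : T -> 'M[R]_(p, q)) (a : 'M[R]_(p, q)) :
  f @ F --> a -> (f x)^T @[x --> F] --> a^T.
Proof.
move=> /cvg_mxP fa; apply/cvg_mxP => i j.
by under eq_fun do rewrite mxE; rewrite mxE; exact: fa.
Qed.

Lemma cvg_mxtrace (p : nat) (f : T -> 'M[R]_p) (a : 'M[R]_p) :
  f @ F --> a -> \tr (f x) @[x --> F] --> \tr a.
Proof.
move=> /cvg_mxP fa; apply: cvg_sumr => i _.
 exact: fa. Qed.

Lemma cvg_det (p : nat) (f : T -> 'M[R]_p) (a : 'M[R]_p) :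
  f @ F --> a -> \det (f x) @[x --> F] --> \det a.
Proof.
move=> /cvg_mxP fa; apply: cvg_sumr => s _; apply: cvgM; first exact: cvg_cst.
by apply: cvg_big => [|i _]; [exact: mul_continuous|exact: fa].
Qed.

Lemma cvg_adjugate (p : nat) (f : T -> 'M[R]_p) (a : 'M[R]_p) :
  f @ F --> a -> \adj (f x) @[x --> F] --> \adj a.
Proof.
move=> /cvg_mxP fa; apply/cvg_mxP => i j.
under eq_fun do rewrite mxE; rewrite mxE.
apply: cvgM; first exact: cvg_cst.
apply: cvg_det; apply/cvg_mxP => k l.
by under eq_fun do rewrite !mxE; rewrite !mxE; exact: fa.
Qed.

Lemma near_unitmx (p : nat) (f : T -> 'M[R]_p) (a : 'M[R]_p) :
  f @ F --> a -> a \in unitmx -> \forall x \near F, f x \in unitmx.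
Proof.
move=> fa; rewrite unitmxE unitfE => a0.
have : \forall x \near F, \det (f x) != 0.
  exact: (@cvgr_neq0 _ _ _ F FF _ _ (cvg_det fa) a0).
by apply: filterS => x; rewrite unitmxE unitfE.
Qed.

(** Cramer's formula is continuous in the entries. It gives [invmx] on invertible matrices only,
    hence the equality holds eventually along [F]. *)
Lemma cvg_invmx (p : nat) (f : T -> 'M[R]_p) (a : 'M[R]_p) :
  f @ F --> a -> a \in unitmx -> invmx (f x) @[x --> F] --> invmx a.
Proof.
move=> fa a_unit.
have f_eq : {near F, (fun x => (\det (f x))^-1 *: \adj (f x)) =1
    (fun x => invmx (f x))}.
  by have := near_unitmx fa a_unit; apply: filterS => x fx; rewrite /invmx fx.
apply: (cvg_trans (near_eq_cvg f_eq)).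
rewrite /invmx a_unit; apply: cvgZ; last exact: cvg_adjugate.
apply: cvgV; last exact: cvg_det.
by rewrite -unitfE -unitmxE.
Qed.

Lemma cvg_mxvec (p q : nat) (f : T -> 'M[R]_(p, q)) (a : 'M[R]_(p, q)) :
  f @ F --> a -> mxvec (f x) @[x --> F] --> mxvec a.
Proof.
move=> /cvg_mxP fa; apply/cvg_mxP => i j.
rewrite ord1; case/mxvec_indexP: j => k l.
by under eq_fun do rewrite mxvecE; rewrite mxvecE; exact: fa.
Qed.

Lemma cvg_vec_mx (p q : nat) (f : T -> 'rV[R]_(p * q)) (a : 'rV[R]_(p * q)) :
  f @ F --> a -> vec_mx (f x) @[x --> F] --> vec_mx a.
Proof.
move=> /cvg_mxP fa; apply/cvg_mxP => i j.
by under eq_fun do rewrite mxE; rewrite mxE; exact: fa.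
Qed.

End MatrixLimits.

(** The form in which stability enters the Lyapunov equations: past [spectral_radius_schur],
    arguments use limits of powers instead of complex eigenvalues. *)
Definition schur (R : realType) (n : nat) (A : 'M[R]_n) : Prop :=
  A ^+ k @[k --> \oo] --> (0 : 'M[R]_n).

Lemma spectral_radius_schur (R : realType) (n : nat) (A : 'M[R]_n) :
  spectral_radius A < 1 -> schur A.
Proof.
case: n A => [|n'] A A1; rewrite /schur.
  by apply: cvg_near_cst; apply: nearW => k; exact: flatmx0.
have [c [r [c0 r0 r1 H]]] := spectral_radius_decay A1.
apply/cvg_mxP => i j; rewrite mxE; apply: norm_cvg0.
apply: (@squeeze_cvgr _ _ _ _ (fun=> 0) (geometric c r)).
- by apply: nearW => k; rewrite normr_ge0/= H.
- exact: cvg_cst.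
- by apply: cvg_geometric; rewrite gtr0_norm.
Qed.

Section Lyapunov.
Context (R : realType) (n : nat).
Implicit Types A W X : 'M[R]_n.

Lemma trmx_exp A k : (A ^+ k)^T = A^T ^+ k.
Proof.
elim: k => [|k IH]; first by rewrite !expr0 trmx1.
by rewrite exprS [RHS]exprSr -IH; exact: trmx_mul.
Qed.

Lemma schur_tr A : schur A -> schur A^T.
Proof.
move=> /cvg_trmx; rewrite trmx0 /schur.
by under eq_fun do rewrite trmx_exp.
Qed.

Lemma schur_sandwich A X :
  schur A -> A ^+ k *m X *m (A ^+ k)^T @[k --> \oo] --> (0 : 'M[R]_n).
Proof.
move=> A0; have := cvg_mulmx (cvg_mulmx A0 (cvg_cst X)) (cvg_trmx A0).
rewrite !mul0mx; exact.
Qed.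

(** The discrete Lyapunov (Stein) operator in coordinates, acting on row vectors [mxvec X] from the
    right. Solvability, uniqueness and continuity of solutions thereby become questions about one
    inverse matrix. *)
Definition lyapmx A : 'M[R]_(n * n) :=
  1%:M - lin_mx (mulmxr A^T \o mulmx A).

Lemma mul_lyapmx A X : mxvec X *m lyapmx A = mxvec (X - A *m X *m A^T).
Proof. by rewrite mulmxBr mulmx1 mul_vec_lin/= linearB. Qed.

(** A kernel element satisfies [X = A *m X *m A^T], hence [X = A ^+ k *m X *m (A ^+ k)^T] for all
    [k], and the right side tends to [0]. *)
Lemma lyapmx_unit A : schur A -> lyapmx A \in unitmx.
Proof.
move=> A0; rewrite -row_free_unit; apply: inj_row_free => v.
rewrite -(vec_mxK v) mul_lyapmx; set X := vec_mx v => /(canRL mxvecK).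
rewrite linear0 => /eqP; rewrite subr_eq0 => /eqP X_eq.
suff -> : X = 0 by rewrite linear0.
have X_k k : A ^+ k *m X *m (A ^+ k)^T = X.
  elim: k => [|k IH]; first by rewrite expr0 trmx1 mul1mx mulmx1.
  rewrite [RHS]X_eq -[in RHS]IH exprS trmx_mul.
  by rewrite !mulmxA.
have := schur_sandwich X A0; under eq_fun do rewrite X_k.
move=> X0; apply: (cvg_unique (@norm_hausdorff _ _) (cvg_cst X) X0).
Qed.

(** A closed formula rather than the series of the [A ^+ k *m W *m (A ^+ k)^T], so that continuity
    in [A] and [W] comes from that of the inverse. *)
Definition dlyap A W : 'M[R]_n := vec_mx (mxvec W *m invmx (lyapmx A)).

Lemma dlyapP A W X :
  lyapmx A \in unitmx -> X = W + A *m X *m A^T <-> X = dlyap A W.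
Proof.
move=> uA; have X_iff : X = W + A *m X *m A^T <-> mxvec X *m lyapmx A = mxvec W.
  rewrite mul_lyapmx; split=> [X_eq|/(can_inj (@mxvecK _ _ _)) <-].
    by rewrite {1}X_eq addrK.
  by rewrite subrK.
apply: (iff_trans X_iff); rewrite /dlyap.
split=> [<-|->]; first by rewrite mulmxK// mxvecK.
by rewrite vec_mxK mulmxKV.
Qed.

Lemma xget_dlyap A W : lyapmx A \in unitmx ->
  xget 0 [set X | X = W + A *m X *m A^T] = dlyap A W.
Proof.
move=> uA; apply/(dlyapP _ _ uA).
have : [set X | X = W + A *m X *m A^T] (dlyap A W) by exact/(dlyapP _ _ uA).
exact: (@xgetI _ 0).
Qed.

Lemma dlyap_sym A W :
  lyapmx A \in unitmx -> W^T = W -> (dlyap A W)^T = dlyap A W.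
Proof.
move=> uA sW; apply/(dlyapP _ _ uA).
rewrite [in LHS](iffRL (dlyapP _ _ uA) erefl).
by rewrite linearD/= sW !trmx_mul trmxK mulmxA.
Qed.

(** Replacing [X] by [A *m X *m A^T = X - W] lowers the quadratic form. The iterates of this
    replacement tend to [0], so the form of [X] dominates a sequence with limit [0]. *)
Lemma dlyap_psd A W : schur A -> psdmx W -> psdmx (dlyap A W).
Proof.
move=> A0 [sW W0]; have uA := lyapmx_unit A0; split; first exact: dlyap_sym.
move=> x; set X := dlyap A W.
have X_eq : X = W + A *m X *m A^T by exact/(dlyapP _ _ uA).
have X_k k :
    (x^T *m (A ^+ k *m X *m (A ^+ k)^T) *m x) 0 0 <= (x^T *m X *m x) 0 0.
  elim: k => [|k]; first by rewrite expr0 trmx1 mul1mx mulmx1.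
  apply: le_trans.
  have -> : A ^+ k.+1 *m X *m (A ^+ k.+1)^T =
      A ^+ k *m (A *m X *m A^T) *m (A ^+ k)^T.
    by rewrite exprSr trmx_mul !mulmxA.
  rewrite [X in _ <= (_ *m (_ *m X *m _) *m _) _ _]X_eq.
  rewrite mulmxDr mulmxDl mulmxDr mulmxDl [leRHS]mxE lerDr.
  by have := W0 ((A ^+ k)^T *m x); rewrite trmx_mul trmxK !mulmxA.
have /cvg_mxP/(_ 0 0) :
    x^T *m (A ^+ k *m X *m (A ^+ k)^T) *m x @[k --> \oo] --> x^T *m 0 *m x.
  apply: cvg_mulmx; last exact: cvg_cst.
  by apply: cvg_mulmx; [exact: cvg_cst|exact: schur_sandwich].
rewrite mulmx0 mul0mx [X in _ --> X]mxE => x0.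
by rewrite -(cvg_lim _ x0)//; apply: limr_le; [exact/cvgP/x0|exact: nearW].
Qed.

Lemma dlyap_ge A W (x : 'cV[R]_n) : schur A -> psdmx W ->
  (x^T *m W *m x) 0 0 <= (x^T *m dlyap A W *m x) 0 0.
Proof.
move=> A0 W0; have [_ X0] := dlyap_psd A0 W0.
rewrite [in leRHS](iffRL (dlyapP _ _ (lyapmx_unit A0)) erefl).
rewrite mulmxDr mulmxDl [leRHS]mxE lerDl.
by have := X0 (A^T *m x); rewrite trmx_mul trmxK !mulmxA.
Qed.

End Lyapunov.

Section LyapunovLimits.
Context (R : realType) (T : Type) (F : set_system T) {FF : Filter F} (n : nat).
Implicit Types (f g : T -> 'M[R]_n) (A W : 'M[R]_n).

Lemma cvg_lyapmx f A : f @ F --> A -> lyapmx (f x) @[x --> F] --> lyapmx A.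
Proof.
move=> fA; apply: cvgB; first exact: cvg_cst.
apply/cvg_mxP => i j.
under eq_fun do rewrite mxE; rewrite mxE.
(* Row [i] of [lin_mx] is the image of the [i]-th basis vector, here the basis matrix [D]. *)
pose D : 'M[R]_n := vec_mx (delta_mx 0 i).
suff /cvg_mxP :
    mxvec (f x *m D *m (f x)^T) @[x --> F] --> mxvec (A *m D *m A^T).
  exact.
apply: cvg_mxvec; apply: cvg_mulmx; last exact: cvg_trmx.
by apply: cvg_mulmx => //; exact: cvg_cst.
Qed.

Lemma cvg_dlyap f g A W : schur A -> f @ F --> A -> g @ F --> W ->
  dlyap (f x) (g x) @[x --> F] --> dlyap A W.
Proof.
move=> A0 fA gW; apply: cvg_vec_mx; apply: cvg_mulmx; first exact: cvg_mxvec.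
by apply: cvg_invmx; [exact: cvg_lyapmx|exact: lyapmx_unit].
Qed.

(** This stands in for openness of the set of stable matrices: unique solvability persists near [A],
    which keeps the [xget] solutions meaningful there. *)
Lemma near_lyapmx_unit f A : schur A -> f @ F --> A ->
  \forall x \near F, lyapmx (f x) \in unitmx.
Proof.
move=> A0 fA; exact: (near_unitmx (cvg_lyapmx fA) (lyapmx_unit A0)).
Qed.

End LyapunovLimits.

(** * Frobenius norm and quadratic forms *)

Section Frobenius.
Context (R : realType).

Lemma frob_innerE (p q : nat) (X Y : 'M[R]_(p, q)) :
  frob_inner X Y = \tr (X^T *m Y).
Proof.
rewrite /frob_inner exchange_big; apply: eq_bigr => j _.
by rewrite mxE; apply: eq_bigr => i _; rewrite mxE.
Qed.

Lemma frob_innerC (p q : nat) (X Y : 'M[R]_(p, q)) :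
  frob_inner X Y = frob_inner Y X.
Proof. by apply: eq_bigr => i _; apply: eq_bigr => j _; rewrite mulrC. Qed.

Lemma frob_innerDl (p q : nat) (X Y Z : 'M[R]_(p, q)) :
  frob_inner (X + Y) Z = frob_inner X Z + frob_inner Y Z.
Proof. by rewrite !frob_innerE linearD/= mulmxDl linearD. Qed.

Lemma frob_innerBl (p q : nat) (X Y Z : 'M[R]_(p, q)) :
  frob_inner (X - Y) Z = frob_inner X Z - frob_inner Y Z.
Proof. by rewrite !frob_innerE linearB/= mulmxBl linearB. Qed.

Lemma frob_innerZl (p q : nat) (a : R) (X Y : 'M[R]_(p, q)) :
  frob_inner (a *: X) Y = a * frob_inner X Y.
Proof. by rewrite !frob_innerE linearZ/= -scalemxAl linearZ. Qed.

Lemma frob_inner_delta (p q : nat) (X : 'M[R]_(p, q)) i j :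
  frob_inner X (delta_mx i j) = X i j.
Proof.
rewrite /frob_inner (bigD1 i)//= (bigD1 j)//= mxE !eqxx mulr1.
rewrite !big1 ?addr0// => [k ki|k kj].
  by rewrite big1// => l _; rewrite mxE (negPf ki) mulr0.
by rewrite mxE (negPf kj) andbF mulr0.
Qed.

Lemma frob_inner_ge0 (p q : nat) (X : 'M[R]_(p, q)) : 0 <= frob_inner X X.
Proof.
by apply: sumr_ge0 => i _; apply: sumr_ge0 => j _; rewrite -expr2 sqr_ge0.
Qed.

Lemma sqr_frob_norm (p q : nat) (X : 'M[R]_(p, q)) :
  frob_norm X ^+ 2 = frob_inner X X.
Proof. by rewrite sqr_sqrtr// frob_inner_ge0. Qed.

Lemma frob_norm_ge0 (p q : nat) (X : 'M[R]_(p, q)) : 0 <= frob_norm X.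
Proof. exact: sqrtr_ge0. Qed.

Lemma frob_normZ (p q : nat) (a : R) (X : 'M[R]_(p, q)) :
  frob_norm (a *: X) = `|a| * frob_norm X.
Proof.
rewrite /frob_norm frob_innerZl frob_innerC frob_innerZl mulrA -expr2.
by rewrite sqrtrM ?sqr_ge0// sqrtr_sqr.
Qed.

Lemma frob_norm_eq0 (p q : nat) (X : 'M[R]_(p, q)) : frob_norm X = 0 -> X = 0.
Proof.
move=> X0; have : frob_inner X X = 0 by rewrite -sqr_frob_norm X0 expr0n.
move=> /eqP; rewrite /frob_inner psumr_eq0; last first.
  by move=> i _; apply: sumr_ge0 => j _; rewrite -expr2 sqr_ge0.
move=> /allP Xi; apply/matrixP => i j; rewrite mxE.
have := Xi i; rewrite mem_index_enum => /(_ isT)/=.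
rewrite psumr_eq0 => [/allP Xij|k _]; last by rewrite -expr2 sqr_ge0.
have := Xij j; rewrite mem_index_enum => /(_ isT)/=.
by rewrite mulf_eq0 orbb => /eqP.
Qed.

(** The vector [<Y,Y> X - <X,Y> Y] has nonnegative square norm, namely [<Y,Y>] times the difference
    of the two sides. *)
Lemma frob_CauchySchwarz (p q : nat) (X Y : 'M[R]_(p, q)) :
  frob_inner X Y ^+ 2 <= frob_inner X X * frob_inner Y Y.
Proof.
have [Y0|Y0] := eqVneq (frob_inner Y Y) 0.
  have -> : Y = 0 by apply: frob_norm_eq0; rewrite /frob_norm Y0 sqrtr0.
  by rewrite frob_innerE mulmx0 linear0 expr0n/= mulr_ge0// frob_inner_ge0.
have Y_gt0 : 0 < frob_inner Y Y by rewrite lt0r Y0 frob_inner_ge0.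
have := frob_inner_ge0 (frob_inner Y Y *: X - frob_inner X Y *: Y).
rewrite frob_innerBl !frob_innerZl ![frob_inner _ (_ - _)]frob_innerC.
rewrite !frob_innerBl !frob_innerZl [frob_inner Y X]frob_innerC.
set x := frob_inner X X; set y := frob_inner Y Y; set z := frob_inner X Y.
have -> : y * (y * x - z * z) - z * (y * z - z * y) = y * (x * y - z ^+ 2).
  by ring.
by rewrite pmulr_rge0// subr_ge0.
Qed.

Lemma frob_inner_le (p q : nat) (X Y : 'M[R]_(p, q)) :
  frob_inner X Y <= frob_norm X * frob_norm Y.
Proof.
apply: le_trans (ler_norm _) _; rewrite -sqrtr_sqr -sqrtrM ?frob_inner_ge0//.
by rewrite ler_wsqrtr// frob_CauchySchwarz.
Qed.

Lemma frob_normD (p q : nat) (X Y : 'M[R]_(p, q)) :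
  frob_norm (X + Y) <= frob_norm X + frob_norm Y.
Proof.
rewrite -(@ler_pXn2r _ 2)// ?nnegrE ?addr_ge0 ?frob_norm_ge0//.
rewrite sqrrD !sqr_frob_norm.
have -> : frob_inner (X + Y) (X + Y) =
    frob_inner X X + frob_inner X Y *+ 2 + frob_inner Y Y.
  rewrite frob_innerDl ![frob_inner _ (_ + _)]frob_innerC !frob_innerDl.
  by rewrite (frob_innerC Y X); ring.
by rewrite lerD2r lerD2l lerMn2r frob_inner_le orbT.
Qed.

(** Each entry of the product pairs a row with a column; Cauchy-Schwarz bounds its square, and the
    bounds sum to the product of the square norms. *)
Lemma frob_normM (p q s : nat) (X : 'M[R]_(p, q)) (Y : 'M[R]_(q, s)) :
  frob_norm (X *m Y) <= frob_norm X * frob_norm Y.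
Proof.
rewrite /frob_norm -sqrtrM ?frob_inner_ge0// ler_wsqrtr//.
rewrite {2}/frob_inner mulr_suml; apply: ler_sum => i _.
rewrite [X in _ * X](_ : _ = \sum_j \sum_k Y k j * Y k j); last first.
  exact: exchange_big.
rewrite mulr_sumr; apply: ler_sum => j _.
have := frob_CauchySchwarz (row i X) (col j Y)^T.
rewrite /frob_inner !big_ord1 -expr2; congr (_ ^+ 2 <= _ * _).
- by rewrite mxE; apply: eq_bigr => k _; rewrite !mxE.
- by apply: eq_bigr => k _; rewrite !mxE.
- by apply: eq_bigr => k _; rewrite !mxE.
Qed.

Lemma cvg_frob_norm (T : Type) (F : set_system T) {FF : Filter F} (p q : nat)
    (f : T -> 'M[R]_(p, q)) (X : 'M[R]_(p, q))  :
  f @ F --> X -> frob_norm (f x) @[x --> F] --> frob_norm X.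
Proof.
move=> /cvg_mxP fX.
apply: (@continuous_cvg _ _ _ _ _ (fun x => frob_inner (f x) (f x)) Num.sqrt).
  exact: sqrt_continuous.
by apply: cvg_sumr => i _; apply: cvg_sumr => j _; apply: cvgM; exact: fX.
Qed.

Lemma quad_form_delta (n : nat) (S : 'M[R]_n) (i : 'I_n) :
  ((delta_mx i 0 : 'cV[R]_n)^T *m S *m (delta_mx i 0 : 'cV[R]_n)) 0 0 = S i i.
Proof. by rewrite trmx_delta -rowE -colE !mxE. Qed.

Lemma psdmx_congr (p q : nat) (S : 'M[R]_p) (X : 'M[R]_(p, q)) :
  psdmx S -> psdmx (X^T *m S *m X).
Proof.
move=> [sS S0]; split; first by rewrite !trmx_mul trmxK sS mulmxA.
by move=> x; have := S0 (X *m x); rewrite trmx_mul !mulmxA.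
Qed.

Lemma psdmxD (p : nat) (S S' : 'M[R]_p) :
  psdmx S -> psdmx S' -> psdmx (S + S').
Proof.
move=> [sS S0] [sS' S0']; split; first by rewrite linearD/= sS sS'.
by move=> x; rewrite mulmxDr mulmxDl mxE addr_ge0.
Qed.

Lemma pdmx_psd (p : nat) (S : 'M[R]_p) : pdmx S -> psdmx S.
Proof.
move=> [sS S0]; split=> // x; have [->|/S0/ltW//] := eqVneq x 0.
by rewrite mulmx0 mxE.
Qed.

Lemma pdmxD (p : nat) (S S' : 'M[R]_p) : pdmx S -> psdmx S' -> pdmx (S + S').
Proof.
move=> [sS S0] [sS' S0']; split; first by rewrite linearD/= sS sS'.
by move=> x x0; rewrite mulmxDr mulmxDl mxE ltr_wpDr// S0.
Qed.

(** For the trace pairing, the Lyapunov operators of [A] and [A^T] are adjoint to each other, hence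
    so are their inverses. *)
Lemma mxtrace_dlyap (n : nat) (A W Y : 'M[R]_n) : schur A ->
  \tr (Y *m dlyap A W) = \tr (dlyap A^T Y *m W).
Proof.
move=> A0; have uA := lyapmx_unit A0; have uAT := lyapmx_unit (schur_tr A0).
set S := dlyap A W; set P := dlyap A^T Y.
have S_eq : W = S - A *m S *m A^T.
  by rewrite {1}/S (iffRL (dlyapP _ _ uA) erefl) addrK.
have P_eq : Y = P - A^T *m P *m A.
  by rewrite {1}/P (iffRL (dlyapP _ _ uAT) erefl) trmxK addrK.
rewrite S_eq P_eq mulmxBl mulmxBr !linearB/=; congr (_ - _).
by rewrite -!mulmxA mxtrace_mulC !mulmxA.
Qed.

(** This expresses that the state covariance dominates the identity. By duality the right side is
    the trace of the adjoint solution with source [Y], whose diagonal dominates that of [Y]. *)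
Lemma mxtrace_dlyap1_ge (n : nat) (A Y : 'M[R]_n) : schur A -> psdmx Y ->
  \tr Y <= \tr (Y *m dlyap A 1%:M).
Proof.
move=> A0 Y0; rewrite mxtrace_dlyap// mulmx1; apply: ler_sum => i _.
rewrite -(quad_form_delta Y) -(quad_form_delta (dlyap _ _)).
exact: dlyap_ge (schur_tr A0) Y0.
Qed.

(** The trace sums the values of the form [G] at the columns of [X]; all are nonnegative, so each
    vanishes. *)
Lemma pdmx_congr_trace_eq0 (p q : nat) (G : 'M[R]_p) (X : 'M[R]_(p, q)) :
  pdmx G -> \tr (X^T *m G *m X) <= 0 -> X = 0.
Proof.
move=> G0 tr0; have [_ Y0] := psdmx_congr X (pdmx_psd G0).
have diag_ge0 i : 0 <= (X^T *m G *m X) i i by rewrite -quad_form_delta.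
have /eqP : \tr (X^T *m G *m X) = 0 by apply/le_anti; rewrite tr0 sumr_ge0.
rewrite psumr_eq0 => [/allP Yi|//]; apply/matrixP => i j; rewrite mxE.
have := Yi j; rewrite mem_index_enum => /(_ isT)/= /eqP Yj.
suff /colP/(_ i) : col j X = 0 by rewrite !mxE.
apply/eqP/negPn/negP => /(G0.2); rewrite colE trmx_mul !mulmxA.
by rewrite -(mulmxA _ X^T) -(mulmxA _ (X^T *m G)) quad_form_delta Yj ltxx.
Qed.

End Frobenius.

(** * The policy gradient *)

Section PolicyGradient.
Context (R : realType) (M n m : nat).
Context (A : 'I_M -> 'M[R]_n) (B : 'I_M -> 'M[R]_(n, m)).
Context (Qc : 'M[R]_n) (Rc : 'M[R]_m).
Context (Qc_psd : psdmx Qc) (Rc_pd : pdmx Rc).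
Implicit Types (j : 'I_M) (K D : 'M[R]_(m, n)).

Local Notation Acl j K := (closed_loop A B j K).
Local Notation stage K := (stage_cost Qc Rc K).
Local Notation P j K := (Pmx A B Qc Rc j K).
Local Notation S j K := (Sigmamx A B j K).
Local Notation J := (JSA A B Qc Rc).

(** The quadratic coefficient in the input of the state-action value function of system [j] under
    the gain [K]. *)
Definition input_hessian j K : 'M[R]_m := Rc + (B j)^T *m P j K *m B j.

Local Notation G := input_hessian.

(** Half the input derivative of that state-action value function at the input [K x], as a matrix
    acting on the state [x]. *)
Definition gain_residual j K : 'M[R]_(m, n) :=
  G j K *m K + (B j)^T *m P j K *m A j.

Local Notation E := gain_residual.

Lemma schur_closed_loop K j : Kjs A B K -> schur (Acl j K).
Proof. by move=> KK; exact: spectral_radius_schur. Qed.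

Lemma stage_psd K : psdmx (stage K).
Proof. by apply: psdmxD Qc_psd _; apply/psdmx_congr/pdmx_psd. Qed.

Lemma SigmamxE K j : lyapmx (Acl j K) \in unitmx ->
  S j K = dlyap (Acl j K) 1%:M.
Proof. exact: xget_dlyap. Qed.

Lemma PmxE K j : lyapmx (Acl j K)^T \in unitmx ->
  P j K = dlyap (Acl j K)^T (stage K).
Proof. by move=> uA; rewrite -xget_dlyap ?trmxK. Qed.

Lemma Pmx_psd K j : Kjs A B K -> psdmx (P j K).
Proof.
move=> /(schur_closed_loop j)/schur_tr A0.
rewrite PmxE; last exact: lyapmx_unit.
exact/dlyap_psd/stage_psd.
Qed.

Lemma Pmx_eq K j : Kjs A B K ->
  P j K = stage K + (Acl j K)^T *m P j K *m Acl j K.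
Proof.
move=> KK; have uA := lyapmx_unit (schur_tr (schur_closed_loop j KK)).
by have := (dlyapP (stage K) (P j K) uA).2 (PmxE uA); rewrite trmxK.
Qed.

Lemma Sigmamx_eq K j : lyapmx (Acl j K) \in unitmx ->
  S j K = 1%:M + Acl j K *m S j K *m (Acl j K)^T.
Proof. by move=> uA; apply/(dlyapP _ _ uA)/SigmamxE. Qed.

Lemma Sigmamx_sym K j : lyapmx (Acl j K) \in unitmx -> (S j K)^T = S j K.
Proof. by move=> uA; rewrite SigmamxE// dlyap_sym// trmx1. Qed.

Lemma input_hessian_pd K j : Kjs A B K -> pdmx (G j K).
Proof. by move=> KK; apply: pdmxD => //; apply/psdmx_congr/Pmx_psd. Qed.

(** The bracket is the Bellman defect of [P j K] under the gain [D + K]; its pairing with the new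
    covariance telescopes through the Lyapunov equation. For [D + K] invertibility of [lyapmx]
    suffices, and the order of the sum matches [shift K]. *)
Lemma cost_difference K D j : Kjs A B K -> lyapmx (Acl j (D + K)) \in unitmx ->
  \tr (stage (D + K) *m S j (D + K)) =
  \tr (P j K) +
  \tr ((D^T *m E j K + (E j K)^T *m D + D^T *m G j K *m D) *m S j (D + K)).
Proof.
move=> KK uA; have [sP _] := Pmx_psd j KK; have [sR _] := Rc_pd.
set X := Acl j (D + K); set SX := S j (D + K).
have -> : D^T *m E j K + (E j K)^T *m D + D^T *m G j K *m D =
    stage (D + K) + X^T *m P j K *m X - P j K.
  have E_eq : E j K = Rc *m K + (B j)^T *m P j K *m Acl j K.
    by rewrite /E /G mulmxDl mulmxDr -!mulmxA -addrA [_ + (B j)^T *m _]addrC.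
  have X_eq : X = Acl j K + B j *m D.
    by rewrite /X /closed_loop mulmxDr addrCA addrC.
  rewrite [X in _ = _ - X](Pmx_eq j KK) E_eq X_eq /G /stage_cost.
  move: (Acl j K) (P j K) sP => C PK sP.
  rewrite !(mulmxDl, mulmxDr, linearD, trmx_mul)/= ?trmx_mul ?trmxK sR sP.
  rewrite !mulmxA.
  (* Once expanded, the products are generalized to opaque matrices, so that [ring] can check the
     identity entry by entry. *)
  move: (D^T *m Rc *m K) (K^T *m Rc *m D) (D^T *m Rc *m D) (K^T *m Rc *m K).
  move: (_ *m B j *m D) (D^T *m _ *m PK *m B j *m D).
  move: (_ *m C) (D^T *m _ *m PK *m C).
  by move=> *; apply/matrixP => k l; rewrite !mxE; ring.
have tr_P : \tr (P j K) = \tr (P j K *m SX) - \tr (X^T *m P j K *m X *m SX).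
  have S_eq : 1%:M = SX - X *m SX *m X^T by rewrite {1}/SX Sigmamx_eq// addrK.
  rewrite -[in LHS](mulmx1 (P j K)) S_eq mulmxBr linearB/=; congr (_ - _).
  by rewrite !mulmxA mxtrace_mulC !mulmxA.
rewrite tr_P; move: (stage _) => Z.
rewrite mulmxBl (mulmxDl Z) linearB linearD/=; ring.
Qed.

Lemma cvg_closed_loop (T : Type) (F : set_system T) {FF : Filter F}
    (f : T -> 'M[R]_(m, n)) K j :
  f @ F --> K -> Acl j (f x) @[x --> F] --> Acl j K.
Proof.
move=> fK; apply: cvgD; first exact: cvg_cst.
by apply: cvg_mulmx => //; exact: cvg_cst.
Qed.

Lemma cvg_stage_cost (T : Type) (F : set_system T) {FF : Filter F}
    (f : T -> 'M[R]_(m, n)) K :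
  f @ F --> K -> stage (f x) @[x --> F] --> stage K.
Proof.
move=> fK; apply: cvgD; first exact: cvg_cst.
apply: cvg_mulmx => //; apply: cvg_mulmx; last exact: cvg_cst.
exact: cvg_trmx.
Qed.

Lemma cvg_Sigmamx (T : Type) (F : set_system T) {FF : Filter F}
    (f : T -> 'M[R]_(m, n)) K j :
  Kjs A B K -> f @ F --> K -> S j (f x) @[x --> F] --> S j K.
Proof.
move=> /(schur_closed_loop j) A0 fK.
have fA : Acl j (f x) @[x --> F] --> Acl j K by exact: cvg_closed_loop.
have S_eq : {near F,
    (fun x => dlyap (Acl j (f x)) 1%:M) =1 (fun x => S j (f x))}.
  apply: filterS (near_lyapmx_unit A0 fA) => x uA; exact/esym/SigmamxE.
apply: (cvg_trans (near_eq_cvg S_eq)).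
rewrite SigmamxE; last exact: lyapmx_unit.
by apply: cvg_dlyap => //; exact: cvg_cst.
Qed.

Lemma cvg_Pmx (T : Type) (F : set_system T) {FF : Filter F}
    (f : T -> 'M[R]_(m, n)) K j :
  Kjs A B K -> f @ F --> K -> P j (f x) @[x --> F] --> P j K.
Proof.
move=> /(schur_closed_loop j)/schur_tr A0 fK.
have fA : (Acl j (f x))^T @[x --> F] --> (Acl j K)^T.
  by apply: cvg_trmx; exact: cvg_closed_loop.
have P_eq : {near F, (fun x => dlyap (Acl j (f x))^T (stage (f x))) =1
    (fun x => P j (f x))}.
  apply: filterS (near_lyapmx_unit A0 fA) => x uA; exact/esym/PmxE.
apply: (cvg_trans (near_eq_cvg P_eq)).
rewrite PmxE; last exact: lyapmx_unit.
by apply: cvg_dlyap => //; exact: cvg_stage_cost.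
Qed.

Lemma cvg_input_hessian (T : Type) (F : set_system T) {FF : Filter F}
    (f : T -> 'M[R]_(m, n)) K j :
  Kjs A B K -> f @ F --> K -> G j (f x) @[x --> F] --> G j K.
Proof.
move=> KK fK; apply: cvgD; first exact: cvg_cst.
apply: cvg_mulmx; last exact: cvg_cst.
by apply: cvg_mulmx; [exact: cvg_cst|exact: cvg_Pmx].
Qed.

(** This is the cost difference for a zero step. *)
Lemma JSA_mxtrace_Pmx K : Kjs A B K -> J K = M%:R^-1 * \sum_j \tr (P j K).
Proof.
move=> KK; congr (_ * _); apply: eq_bigr => j _.
have uA := lyapmx_unit (schur_closed_loop j KK).
have := @cost_difference K 0 j KK; rewrite add0r => ->//.
by rewrite trmx0 !mul0mx mulmx0 !addr0 mul0mx linear0 addr0.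
Qed.

Lemma gradient_JSA K : Kjs A B K ->
  gradient J K = (M%:R^-1 * 2) *: \sum_j E j K *m S j K.
Proof.
move=> KK; set Y := RHS; apply/matrixP => k l; rewrite mxE.
set D := delta_mx k l.
rewrite -(frob_inner_delta Y) -/D /derive.
apply: cvg_lim => //.
(* The difference quotient with the factor [h] cancelled exactly; this expression extends
   continuously to [h = 0]. *)
pose q h := M%:R^-1 * \sum_j \tr ((D^T *m E j K + (E j K)^T *m D
  + h *: (D^T *m G j K *m D)) *m S j (h *: D + K)).
have K_h : h *: D + K @[h --> (0 : R)^'] --> K.
  rewrite -[X in _ --> X]add0r -(scale0r D); apply: cvgD; last exact: cvg_cst.
  by apply: cvgZ; [exact: nbhs_dnbhs|exact: cvg_cst].
have q_eq : {near (0 : R)^', q =1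
    (fun h => h^-1 *: ((J \o shift K) (h *: D) - J K))}.
  have uA_near : \forall h \near (0 : R)^', forall j,
      lyapmx (Acl j (h *: D + K)) \in unitmx.
    apply: filter_forall => j.
    have A_h : Acl j (h *: D + K) @[h --> (0 : R)^'] --> Acl j K.
      exact: cvg_closed_loop.
    exact: near_lyapmx_unit (schur_closed_loop j KK) A_h.
  have h_neq0 : \forall h \near (0 : R)^', h != 0 by exact: nbhs_dnbhs_neq.
  apply: filterS (filterI h_neq0 uA_near) => h [h0 uA].
  rewrite /q [J K](JSA_mxtrace_Pmx KK) [X in _ = _ *: (X - _)]/= /JSA.
  rewrite -mulrBr -sumrB -[RHS]/(h^-1 * _) mulrCA.
  congr (_ * _); rewrite mulr_sumr; apply: eq_bigr => j _.
  rewrite (cost_difference KK (uA j)) [X in _ = _ * (X - _)]addrC addrK.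
  rewrite -mxtraceZ [in RHS]scalemxAl; congr (\tr (_ *m _)).
  rewrite [(h *: D)^T]linearZ/= -!scalemxAl -!scalemxAr -!scalerDr scalerA.
  by rewrite mulVf// scale1r.
apply: (cvg_trans (near_eq_cvg q_eq)).
have -> : frob_inner Y D = M%:R^-1 * \sum_j \tr ((D^T *m E j K + (E j K)^T *m D
  + 0 *: (D^T *m G j K *m D)) *m S j K).
  rewrite frob_innerZl -mulrA; congr (_ * _).
  rewrite frob_innerC frob_innerE mulmx_sumr linear_sum mulr_sumr.
  apply: eq_bigr => j _; rewrite scale0r addr0 mulmxDl linearD/=.
  rewrite mulr_natl mulr2n mulmxA; congr (_ + _).
  (* The two linear terms have the same trace against the symmetric covariance, whence the factor
     [2] in the gradient. *)
  rewrite -[RHS]mxtrace_tr !trmx_mul trmxK Sigmamx_sym; last first.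
    exact/lyapmx_unit/schur_closed_loop.
  by rewrite mxtrace_mulC.
apply: cvgM; first exact: cvg_cst.
apply: cvg_sumr => j _; apply: cvg_mxtrace.
apply: cvg_mulmx; last exact: cvg_Sigmamx.
apply: cvgD; first exact: cvg_cst.
by apply: cvgZ; [exact: nbhs_dnbhs|exact: cvg_cst].
Qed.

(** The equation is a square linear system, so injectivity yields a solution for [xget] to pick. If
    [X] is in the kernel, pairing with [X] gives a zero sum of terms [tr (X^T G_j X Sigma_j)], each
    at least [tr (X^T G_j X) >= 0]; positive definiteness of a single [G_j] forces [X = 0]. *)
Lemma Khat_eq K : (0 < M)%N -> Kjs A B K ->
  \sum_j (G j K *m Khat A B Qc Rc K + (B j)^T *m P j K *m A j) *m S j K = 0.
Proof.
move=> M0 KK.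
have uA j := lyapmx_unit (schur_closed_loop j KK).
pose N := \sum_j lin_mx (mulmxr (S j K) \o mulmx (G j K)).
have mulN X : mxvec X *m N = mxvec (\sum_j G j K *m X *m S j K).
  by rewrite mulmx_sumr linear_sum; apply: eq_bigr => j _; rewrite mul_vec_lin.
have N_unit : N \in unitmx.
  rewrite -row_free_unit; apply: inj_row_free => v.
  rewrite -(vec_mxK v) mulN; set X := vec_mx v => /(canRL mxvecK).
  rewrite linear0 => GXS0; suff -> : X = 0 by rewrite linear0.
  have tr_ge j : \tr (X^T *m G j K *m X) <= \tr (X^T *m G j K *m X *m S j K).
    rewrite SigmamxE//.
    apply: mxtrace_dlyap1_ge; first exact: schur_closed_loop.
    exact/psdmx_congr/pdmx_psd/input_hessian_pd.
  have tr_ge0 j : 0 <= \tr (X^T *m G j K *m X).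
    apply: sumr_ge0 => i _; rewrite -quad_form_delta.
    by apply: (psdmx_congr X _).2; exact/pdmx_psd/input_hessian_pd.
  have tr0 : \sum_j \tr (X^T *m G j K *m X *m S j K) = 0.
    rewrite -[RHS](linear0 (@mxtrace R n)) -(mulmx0 n X^T) -GXS0.
    rewrite mulmx_sumr linear_sum.
    by apply: eq_bigr => j _; rewrite !mulmxA.
  apply: (@pdmx_congr_trace_eq0 _ _ _ (G (Ordinal M0) K)).
    exact: input_hessian_pd.
  apply: le_trans (tr_ge _) _; rewrite -tr0 (bigD1 (Ordinal M0))//= lerDl.
  by apply: sumr_ge0 => j _; apply: le_trans (tr_ge j).
pose Y := - \sum_j (B j)^T *m P j K *m A j *m S j K.
pose X0 := vec_mx (mxvec Y *m invmx N).
have X0_eq : \sum_j G j K *m X0 *m S j K = Y.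
  by apply: (can_inj mxvecK); rewrite -mulN vec_mxK mulmxKV.
apply: (@xgetI _ 0
  [set X | \sum_j (G j K *m X + (B j)^T *m P j K *m A j) *m S j K = 0] X0).
rewrite /=; under eq_bigr do rewrite mulmxDl.
by rewrite big_split/= X0_eq addNr.
Qed.

Lemma gradient_JSA_Delta K : (0 < M)%N -> Kjs A B K ->
  gradient J K =
  - ((M%:R^-1 * 2) *: \sum_j G j K *m Delta A B Qc Rc K *m S j K).
Proof.
move=> M0 KK; rewrite gradient_JSA// -scalerN; congr (_ *: _).
apply/eqP; rewrite -addr_eq0 -big_split/= -[X in _ == X](Khat_eq M0 KK).
apply/eqP/eq_bigr => j _; rewrite -mulmxDl /Delta /E mulmxBr; congr (_ *m _).
by rewrite addrC addrA subrK.
Qed.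

Lemma gradient_JSA_le (C : set 'M[R]_(m, n)) :
  (0 < M)%N -> compact C -> C `<=` Kjs A B ->
  exists c : R, forall K, C K ->
    frob_norm (gradient J K) <= c * frob_norm (Delta A B Qc Rc K).
Proof.
move=> M0 cptC CK; have [->|C0] := eqVneq C set0; first by exists 0.
(* The factor that the triangle inequality and submultiplicativity produce. It is continuous on [C],
   and its maximum there is the constant sought. *)
pose b K := M%:R^-1 * 2 * \sum_j frob_norm (G j K) * frob_norm (S j K).
have b_cvg (F : set_system 'M[R]_(m, n)) (FF : Filter F) K :
    Kjs A B K -> F --> K -> b X @[X --> F] --> b K.
  move=> KK FK; apply: cvgM; first exact: cvg_cst.
  apply: cvg_sumr => j _; apply: cvgM; apply: cvg_frob_norm.
    exact: cvg_input_hessian.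
  exact: cvg_Sigmamx.
have b_cont : {within C, continuous b}.
  apply: continuous_in_subspaceT => K /set_mem /CK KK.
  exact: (b_cvg (nbhs K) _ K KK).
have [K1 _ b_le] := compact_EVT_max ((set0P _).1 C0) cptC b_cont.
exists (b K1) => K KC.
apply: (@le_trans _ _ (b K * frob_norm (Delta A B Qc Rc K))); last first.
  by rewrite ler_wpM2r ?frob_norm_ge0// b_le ?inE.
rewrite gradient_JSA_Delta//; last exact: CK.
rewrite -scaleN1r frob_normZ normrN1 mul1r frob_normZ /b.
rewrite ger0_norm ?mulr_ge0 ?invr_ge0// -mulrA ler_wpM2l ?mulr_ge0 ?invr_ge0//.
rewrite mulr_suml.
have frob_norm_sum (I : Type) (r : seq I) (f : I -> 'M[R]_(m, n)) :
    frob_norm (\sum_(i <- r) f i) <= \sum_(i <- r) frob_norm (f i).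
  elim: r => [|i r IH].
    by rewrite !big_nil /frob_norm frob_innerE mulmx0 linear0 sqrtr0.
  by rewrite !big_cons (le_trans (frob_normD _ _))// lerD2l.
apply: le_trans (frob_norm_sum _ _ _) _; apply: ler_sum => j _.
apply: le_trans (frob_normM _ _) _; rewrite mulrAC ler_wpM2r ?frob_norm_ge0//.
exact: frob_normM.
Qed.

End PolicyGradient.

(** * Descent along a segment *)

Lemma is_derive_quadratic (R : realType) (c d t : R) :
  is_derive t 1 (fun s => c * s - d * s ^+ 2) (c - d * t *+ 2).
Proof.
have -> : (fun s => c * s - d * s ^+ 2) = horner (c *: 'X - d *: 'X^2).
  by apply/funext => s; rewrite hornerD hornerN !hornerZ hornerX hornerXn.
apply: is_derive_eq (is_derive_poly _ _) _.
rewrite derivB !derivZ derivX derivXn hornerD hornerN !hornerZ hornerC hornerMn.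
by rewrite hornerX mulr1 mulrnAr.
Qed.

Section Descent.
Context (R : realType) (p q : nat).
Implicit Types (f : 'M[R]_(p, q) -> R) (K V : 'M[R]_(p, q)).

Lemma derive_gradient f K V : differentiable f K ->
  'D_V f K = frob_inner (gradient f K) V.
Proof.
move=> dfK; rewrite deriveE// [in LHS](matrix_sum_delta V) linear_sum.
apply: eq_bigr => i _; rewrite linear_sum; apply: eq_bigr => j _.
by rewrite linearZ mxE deriveE// mulrC.
Qed.

Lemma is_derive_line f K V (t : R) : differentiable f (K + t *: V) ->
  is_derive t 1 (fun s => f (K + s *: V))
    (frob_inner (gradient f (K + t *: V)) V).
Proof.
move=> dfK; rewrite -derive_gradient//.
pose g s := f (K + s *: V).
have quot_eq :
    (fun h : R => h^-1 *: ((g \o shift t) (h *: (1 : R)) - g t)) =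
    (fun h : R =>
      h^-1 *: ((f \o shift (K + t *: V)) (h *: V) - f (K + t *: V))).
  apply/funext => h /=; congr (_ *: (f _ - _)).
  by rewrite /= -[h *: 1]/(h * 1) mulr1 scalerDl addrCA.
split; first by rewrite /derivable quot_eq; exact: diff_derivable.
by rewrite /derive quot_eq.
Qed.

Lemma within_continuous_of_differentiable f (C : set 'M[R]_(p, q)) :
  (forall K, C K -> differentiable f K) -> {within C, continuous f}.
Proof.
move=> df; apply: continuous_in_subspaceT => K /set_mem/df.
exact: differentiable_continuous.
Qed.

(** The Lipschitz bound is used only between points of the segment, which lies in [C]. The slope
    bound is exported as well because [descent_step] needs it at the endpoint. *)
Lemma smooth_descent f (C : set 'M[R]_(p, q)) K V (L c a : R) :
  (forall X, C X -> differentiable f X) -> smooth_on L f C -> 0 <= a ->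
  (forall t, 0 <= t <= a -> C (K + t *: V)) ->
  frob_inner (gradient f K) V <= - c * frob_norm V ^+ 2 ->
  (forall t, 0 <= t <= a ->
    frob_inner (gradient f (K + t *: V)) V <= (L * t - c) * frob_norm V ^+ 2) /\
  f (K + a *: V) <=
    f K - (c * frob_norm V ^+ 2 * a - L / 2 * frob_norm V ^+ 2 * a ^+ 2).
Proof.
move=> df smooth_f a0 CK descent.
have slope t : 0 <= t <= a ->
    frob_inner (gradient f (K + t *: V)) V <= (L * t - c) * frob_norm V ^+ 2.
  move=> ta; have t0 : 0 <= t by case/andP: ta.
  have K_C : C K by have := CK 0; rewrite scale0r addr0; apply; rewrite lexx.
  rewrite -(subrK (gradient f K) (gradient f _)) frob_innerDl.
  rewrite mulrBl -[- (c * _)]mulNr lerD//.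
  apply: le_trans (frob_inner_le _ _) _.
  rewrite expr2 mulrA ler_wpM2r ?frob_norm_ge0//.
  apply: le_trans (smooth_f _ _ (CK t ta) K_C) _.
  by rewrite addrAC subrr add0r frob_normZ ger0_norm// mulrA.
split=> //; set N := frob_norm V ^+ 2 in slope *.
(* [f] along the segment minus its quadratic upper model, up to a constant; the slope bound says
   that its derivative is nonpositive. *)
pose psi t := f (K + t *: V) + (c * N * t - L / 2 * N * t ^+ 2).
have psi_derive t : 0 <= t <= a -> is_derive t 1 psi
    (frob_inner (gradient f (K + t *: V)) V + (c - L * t) * N).
  move=> ta; have := is_derive_line (df _ (CK t ta)) => dline.
  have dquad := is_derive_quadratic (c * N) (L / 2 * N) t.
  apply: is_derive_eq (is_deriveD dline dquad) _.
  by congr (_ + _); field.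
have psi_le : psi a <= psi 0.
  have itvP t : t \in `]0, a[ -> 0 <= t <= a.
    by rewrite in_itv/= => /andP[t0 ta]; rewrite !ltW.
  apply: (@ler0_derive1_le_cc _ psi 0 a) => //; rewrite ?in_itv/= ?lexx ?a0//.
  - by move=> t /itvP/psi_derive[].
  - move=> t /itvP ta.
    rewrite derive1E (derive_val (is_derive := psi_derive t ta)).
    by rewrite -[c - _]opprB mulNr subr_le0; exact: slope.
  - apply: continuous_in_subspaceT => t /set_mem; rewrite /= in_itv/= => ta.
    have [/derivable1_diffP/differentiable_continuous] := psi_derive t ta.
    exact.
move: psi_le; rewrite /psi scale0r addr0 expr0n/= !mulr0 subr0 addr0.
by rewrite -lerBrDr.
Qed.

Lemma descent_step f (D : set 'M[R]_(p, q)) (gamma L c alpha : R) K V :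
  let C := [set X | D X /\ f X <= gamma] in
  compact C -> (forall X, C X -> differentiable f X) -> smooth_on L f C ->
  0 < L -> 0 <= alpha <= c / L -> C K ->
  frob_inner (gradient f K) V <= - c * frob_norm V ^+ 2 ->
  (forall a, 0 <= a <= alpha -> D (K + a *: V)) ->
  C (K + alpha *: V) /\
  f (K + alpha *: V) <= f K - c * alpha / 2 * frob_norm V ^+ 2.
Proof.
move=> C cptC df smooth_f L0 /andP[alpha0 alpha_le] KC descent feasible.
have closedC : closed C by apply: compact_closed cptC; exact: norm_hausdorff.
(* The argument below needs a strictly negative slope, which fails for [V = 0]. *)
have [->|V0] := eqVneq V 0.
  rewrite scaler0 addr0; split=> //.
  by rewrite /frob_norm frob_innerE mulmx0 linear0 sqrtr0 expr0n/= mulr0 subr0.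
have N0 : 0 < frob_norm V ^+ 2.
  rewrite exprn_gt0// lt0r frob_norm_ge0 andbT.
  by apply: contraNneq V0 => /frob_norm_eq0 ->.
(* Step lengths whose whole initial segment stays in [C]. Closedness of [C] makes the supremum [s]
   itself good. *)
pose good :=
  [set a | 0 <= a <= alpha /\ forall t, 0 <= t <= a -> C (K + t *: V)].
have good0 : good 0.
  split=> [|t]; first by rewrite lexx.
  by move=> /le_anti <-; rewrite scale0r addr0.
have good_ub : has_ubound good by exists alpha => a [/andP[]].
pose s := sup good.
have s0 : 0 <= s by exact: ub_le_sup.
have s_le : s <= alpha by apply: ge_sup => [|a [/andP[]]//]; exists 0.
have C_lt t : 0 <= t < s -> C (K + t *: V).
  move=> /andP[t0 /sup_gt[|a [_ aC] ta]]; first by exists 0.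
  by apply: aC; rewrite t0 ltW.
have C_s : C (K + s *: V).
  have [<-|s_neq0] := eqVneq 0 s; first by rewrite scale0r addr0.
  have s_gt0 : 0 < s by rewrite lt0r eq_sym s_neq0.
  have line_cvg : K + t *: V @[t --> s^'-] --> K + s *: V.
    apply: cvgD; first exact: cvg_cst.
    by apply: cvgZ; [exact: cvg_at_left_filter|exact: cvg_cst].
  apply: (@closed_cvg _ _ _ _ (fun t : R => K + t *: V) C closedC _ _ line_cvg).
  near=> t; apply: C_lt; apply/andP; split; last first.
    by near: t; exact: nbhs_left_lt.
  by near: t; apply: nbhs_left_ge.
have C_le t : 0 <= t <= s -> C (K + t *: V).
  move=> /andP[t0]; rewrite le_eqVlt => /predU1P[->//|ts].
  by apply: C_lt; rewrite t0.
have [slope f_le] := smooth_descent df smooth_f s0 C_le descent.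
have s_eq : s = alpha.
  apply/eqP; rewrite eq_le s_le leNgt; apply/negP => s_lt.
  have slope_lt0 : frob_inner (gradient f (K + s *: V)) V < 0.
    apply: le_lt_trans (slope s _) _; first by rewrite s0 lexx.
    rewrite pmulr_llt0// subr_lt0 mulrC -ltr_pdivlMr//.
    exact: lt_le_trans alpha_le.
  have [dline line_val] := is_derive_line (df _ C_s).
  pose g t := f (K + t *: V).
  pose quot (h : R) := h^-1 *: ((g \o shift s) (h *: (1 : R)) - g s).
  have quot_cvg : quot @ (0 : R)^' --> frob_inner (gradient f (K + s *: V)) V.
    by rewrite -line_val; exact: dline.
  have : \forall h \near (0 : R)^', quot h < 0 by exact: cvgr_lt slope_lt0.
  move=> /nbhs_ballP[e /= e0 quot_lt0].
  (* Half the radius keeps [t - s] strictly inside the ball of negative quotients, and the cap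
     [alpha] keeps the points feasible. Thus [s'] is good and exceeds [s], a contradiction. *)
  pose s' := Num.min alpha (s + e / 2).
  have s_lt' : s < s' by rewrite lt_min s_lt ltrDl divr_gt0.
  suff /(ub_le_sup good_ub) : good s' by rewrite leNgt s_lt'.
  split=> [|t /andP[t0]].
    by rewrite ge_min lexx (le_trans s0 (ltW s_lt')).
  rewrite le_min => /andP[t_alpha t_le].
  have [t_s|s_t] := leP t s; first by apply: C_le; rewrite t0.
  split; first by apply: feasible; rewrite t0.
  have h0 : 0 < t - s by rewrite subr_gt0.
  have /quot_lt0 : ball (0 : R) e (t - s).
    rewrite /ball/= sub0r normrN gtr0_norm//.
    rewrite ltrBlDl (le_lt_trans t_le)// ltrD2l.
    by rewrite ltr_pdivrMr// ltr_pMr// ltr1n.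
  move=> /(_ (lt0r_neq0 h0)).
  rewrite /quot /g /= -[(t - s) *: 1]/((t - s) * 1) mulr1 subrK.
  rewrite -[_ *: _]/(_ * _) pmulr_rlt0 ?invr_gt0// subr_lt0.
  move=> /ltW/le_trans; apply.
  by case: C_s.
rewrite -s_eq; split=> //; apply: le_trans f_le _.
(* As [L * s <= c], half of the linear decrease absorbs the quadratic term. *)
rewrite lerD2l lerN2 -subr_ge0; set N := _ ^+ 2.
have -> : c * N * s - L / 2 * N * s ^+ 2 - c * s / 2 * N =
    N * s / 2 * (c - L * s).
  by field.
apply: mulr_ge0; first by rewrite divr_ge0// mulr_ge0// ltW.
by rewrite subr_ge0 mulrC -ler_pdivlMr// s_eq.
Unshelve. all: by end_near.
Qed.

(** Every neighbourhood of the cluster point [X] meets the points of [C] with small gradient, and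
    the Lipschitz bound carries smallness over to [X]; each of the two contributes [e / 2], and no
    subsequence is extracted. *)
Lemma cluster_gradient_eq0 f (C : set 'M[R]_(p, q)) (L : R)
    (u : nat -> 'M[R]_(p, q)) (X : 'M[R]_(p, q)) :
  0 < L -> smooth_on L f C -> (forall i, C (u i)) -> C X ->
  frob_norm (gradient f (u i)) @[i --> \oo] --> (0 : R) ->
  cluster (u @ \oo) X -> gradient f X = 0.
Proof.
move=> L0 smooth_f Cu CX grad0 clX.
apply/frob_norm_eq0/le_anti; rewrite frob_norm_ge0 andbT.
apply/ler_addgt0Pl => e e0; rewrite addr0.
have e2 : 0 < e / 2 by rewrite divr_gt0.
have near_X (F : set_system 'M[R]_(p, q)) : Filter F -> F --> X ->
    \forall Y \near F, frob_norm (X - Y) <= e / 2 / L.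
  move=> FF FX.
  have dist0 : frob_norm (X - Y) @[Y --> F] --> frob_norm (X - X).
    by apply: cvg_frob_norm; apply: cvgB => //; exact: cvg_cst.
  have -> : e / 2 / L = frob_norm (X - X) + e / 2 / L.
    by rewrite subrr /frob_norm frob_innerE mulmx0 linear0 sqrtr0 add0r.
  by apply: (cvgr_le _ dist0); rewrite ltrDl divr_gt0.
have small : \forall i \near \oo, frob_norm (gradient f (u i)) <= e / 2.
  by apply: (cvgr_le _ grad0).
have [] := clX [set Y | C Y /\ frob_norm (gradient f Y) <= e / 2]
  [set Y | frob_norm (X - Y) <= e / 2 / L].
- by apply: filterS small => i ui; split.
- by apply: (near_X (nbhs X)).
move=> Y [[CY gradY] XY]; rewrite -(subrK (gradient f Y) (gradient f X)).
apply: le_trans (frob_normD _ _) _; rewrite [leRHS]splitr lerD//.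
apply: le_trans (smooth_f _ _ CX CY) _.
by rewrite mulrC -ler_pdivlMr.
Qed.

End Descent.

(** * Convergence of the policy iterates *)

Theorem theorem4 (R : realType) (M n m : nat) (M_ge1 : (1 <= M)%N)
    (A : 'I_M -> 'M[R]_n) (B : 'I_M -> 'M[R]_(n, m))
    (Qc : 'M[R]_n) (Rc : 'M[R]_m) (Qc_psd : psdmx Qc) (Rc_pd : pdmx Rc)
    (gamma L c_d abar : R) (K_ : nat -> 'M[R]_(m, n))
    (Kjs_nonempty : Kjs A B !=set0)
    (sub_compact : compact (Kjs_sub A B Qc Rc gamma))
    (J_C1 : C1_on (JSA A B Qc Rc) (Kjs_sub A B Qc Rc gamma))
    (L_gt0 : 0 < L)
    (J_smooth : smooth_on L (JSA A B Qc Rc) (Kjs_sub A B Qc Rc gamma))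
    (c_d_gt0 : 0 < c_d)
    (descent : forall K, Kjs_sub A B Qc Rc gamma K ->
       frob_inner (gradient (JSA A B Qc Rc) K) (Delta A B Qc Rc K)
         <= - c_d * frob_norm (Delta A B Qc Rc K) ^+ 2)
    (abar_gt0 : 0 < abar)
    (K0_sub : Kjs_sub A B Qc Rc gamma (K_ 0%N))
    (K_step : forall i,
       K_ i.+1 = K_ i + Num.min abar (c_d / L) *: Delta A B Qc Rc (K_ i))
    (abar_feasible : forall (i : nat) (a : R), 0 <= a <= abar ->
       Kjs A B (K_ i + a *: Delta A B Qc Rc (K_ i))) :
  [/\ (forall i, Kjs_sub A B Qc Rc gamma (K_ i)) /\
        (exists Kbar : 'M[R]_(m, n), cluster (K_ @ \oo) Kbar),
      (forall i, JSA A B Qc Rc (K_ i.+1) <= JSA A B Qc Rc (K_ i)) /\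
        cvgn (fun i => JSA A B Qc Rc (K_ i)),
      frob_norm (Delta A B Qc Rc (K_ i)) @[i --> \oo] --> (0 : R),
      frob_norm (gradient (JSA A B Qc Rc) (K_ i)) @[i --> \oo] --> (0 : R) &
      forall Kbar : 'M[R]_(m, n),
        cluster (K_ @ \oo) Kbar -> stationary A B Qc Rc Kbar].
Proof.
set J := JSA A B Qc Rc in J_C1 J_smooth descent *.
set C := Kjs_sub A B Qc Rc gamma in sub_compact J_C1 J_smooth descent K0_sub *.
pose D i := Delta A B Qc Rc (K_ i); rewrite -/C.
set alpha := Num.min abar (c_d / L) in K_step.
have [dJ _] := J_C1.
have alpha_gt0 : 0 < alpha by rewrite lt_min abar_gt0 divr_gt0.
have step i : C (K_ i) ->
    C (K_ i.+1) /\
    J (K_ i.+1) <= J (K_ i) - c_d * alpha / 2 * frob_norm (D i) ^+ 2.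
  move=> KiC; rewrite K_step.
  apply: (descent_step sub_compact dJ J_smooth L_gt0 _ KiC (descent _ KiC)).
    by rewrite (ltW alpha_gt0) ge_min lexx orbT.
  move=> a /andP[a0 a_le]; apply: abar_feasible; rewrite a0 (le_trans a_le)//.
  by rewrite ge_min lexx.
have KC i : C (K_ i) by elim: i => // i /step[].
have J_dec i : J (K_ i.+1) <= J (K_ i) - c_d * alpha / 2 * frob_norm (D i) ^+ 2.
  by case: (step i (KC i)).
have ca_gt0 : 0 < c_d * alpha / 2 by rewrite divr_gt0// mulr_gt0.
have J_le i : J (K_ i.+1) <= J (K_ i).
  apply: le_trans (J_dec i) _.
  rewrite gerBl mulr_ge0// ?exprn_ge0 ?frob_norm_ge0//.
  exact: ltW.
have J_cvg : cvgn (fun i => J (K_ i)).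
  apply: nonincreasing_is_cvgn; first exact/nonincreasing_seqP.
  (* The costs are bounded below by the minimum of [J] on the compact sublevel set. *)
  have J_cont := within_continuous_of_differentiable dJ.
  have [|X _ X_min] := compact_EVT_min _ sub_compact J_cont.
    by exists (K_ 0).
  by exists (J X) => _ [i _ <-]; apply: X_min; rewrite inE.
have D_cvg : frob_norm (D i) @[i --> \oo] --> (0 : R).
  have sqr_cvg : frob_norm (D i) ^+ 2 @[i --> \oo] --> (0 : R).
    (* The scaled decrease dominates the squared norm of [D i], and tends to [0] as a difference of
       consecutive terms of a convergent sequence. *)
    pose gap i := (J (K_ i) - J (K_ i.+1)) / (c_d * alpha / 2).
    have gap_cvg : gap @ \oo --> (0 : R).
      rewrite -(mul0r (c_d * alpha / 2)^-1).
      rewrite -(subrr (limn (fun i => J (K_ i)))).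
      apply: cvgM; last exact: cvg_cst.
      by apply: cvgB => //; rewrite (cvg_shiftS (fun i => J (K_ i))).
    apply: (@squeeze_cvgr _ _ _ _ (fun=> 0) gap) => //; last exact: cvg_cst.
    apply: nearW => i; rewrite exprn_ge0 ?frob_norm_ge0//=.
    by rewrite ler_pdivlMr// mulrC lerBrDr -lerBrDl.
  rewrite -(sqrtr0 R).
  under eq_fun do rewrite -[frob_norm _]ger0_norm ?frob_norm_ge0// -sqrtr_sqr.
  apply: (@continuous_cvg _ _ _ _ _ _ Num.sqrt) sqr_cvg.
  exact: sqrt_continuous.
have [c c_bound] : exists c : R, forall K, C K ->
    frob_norm (gradient J K) <= c * frob_norm (Delta A B Qc Rc K).
  by apply: gradient_JSA_le => // K [].
have grad_cvg : frob_norm (gradient J (K_ i)) @[i --> \oo] --> (0 : R).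
  apply: (@squeeze_cvgr _ _ _ _ (fun=> 0) (fun i => c * frob_norm (D i))).
  - by apply: nearW => i; rewrite frob_norm_ge0/= c_bound.
  - exact: cvg_cst.
  - by rewrite -(mulr0 c); apply: cvgM => //; exact: cvg_cst.
split=> //.
- split=> //; have KC_near : (K_ @ \oo) C by exists 0%N => // i _; exact: KC.
  by have [X [_ clX]] := sub_compact (K_ @ \oo) _ KC_near; exists X.
- move=> X clX.
  (* Compactness makes [C] closed, so [X] lies in it and the smoothness hypotheses apply at [X]. *)
  have CX : C X.
    have closedC : closed C.
      by apply: compact_closed sub_compact; exact: norm_hausdorff.
    apply: closedC => U XU; apply: clX => //.
    by exists 0%N => // i _; exact: KC.
  split; [by case: CX|exact: dJ|].
  exact: cluster_gradient_eq0 J_smooth KC CX grad_cvg clX.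
Qed.
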